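(* Let $\mathcal{H}$ be a real Hilbert space, let $u_1,u_2\in\mathcal{H}$, let $\eta_1,\eta_2\in\mathbb{R}$, and set $H_1:=\{x\in\mathcal{H}:\langle x,u_1\rangle=\eta_1\}$ and $W_2:=\{x\in\mathcal{H}:\langle x,u_2\rangle\le\eta_2\}$. Then exactly one of the following cases occurs, with the stated conclusions. (i) $u_1$ and $u_2$ are linearly dependent. Then, provided $H_1\cap W_2\neq\varnothing$, $P_{W_2}P_{H_1}=P_{H_1\cap W_2}=P_{H_1}P_{W_2}$. (ii) $u_1$ and $u_2$ are linearly independent. Then: (a) If $\langle u_1,u_2\rangle=0$, then $P_{W_2}P_{H_1}=P_{H_1\cap W_2}=P_{H_1}P_{W_2}$. (b) If $\langle u_1,u_2\rangle\neq0$, set $\gamma:=\frac{|\langle u_1,u_2\rangle|}{\|u_1\|\|u_2\|}$. Then $\gamma\in[0,1)$. Moreover: (1) for every $x\in\mathcal{H}$ and every $k\in\mathbb{N}$, $\|(P_{W_2}P_{H_1})^kx-P_{H_1\cap W_2}x\|\le\gamma^k\|x-P_{H_1\cap W_2}x\|$; (2) let $x\in\mathcal{H}$ and $k\in\mathbb{N}$, and suppose $P_{H_1}P_{W_2}x\notin H_1\cap W_2$. If $x\in W_2$, then $\|P_{W_2}(P_{H_1}P_{W_2})^kx-P_{H_1\cap W_2}x\|\le\gamma^k\|x-P_{H_1\cap W_2}x\|$; if $x\in W_2^c$, then $\|(P_{H_1}P_{W_2})^kx-P_{H_1\cap W_2}x\|\le\gamma^k\|x-P_{H_1\cap W_2}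x\|$.
   Context: $\mathbb{N}=\{0,1,2,\ldots\}$. For a nonempty closed convex set $C\subseteq\mathcal{H}$, $P_C$ maps each point of $\mathcal{H}$ to its unique nearest point in $C$; juxtaposition denotes composition. $W_2^c:=\mathcal{H}\smallsetminus W_2$. When $u_1,u_2$ are linearly independent, $H_1\cap W_2$ is nonempty. *)

(* Defs.v *)
From HB Require Import structures.
From mathcomp Require Import all_boot all_order all_algebra sesquilinear.
From mathcomp Require Import all_classical all_reals all_analysis.
Set Implicit Arguments.
Unset Strict Implicit.
Unset Printing Implicit Defensive.
Import Order.TTheory GRing.Theory Num.Theory.
Import numFieldNormedType.Exports.
Local Open Scope classical_set_scope.
Local Open Scope ring_scope.

(* A real Hilbert space is a complete normed module H over R together with
   dot : {dot H for idfun}, i.e. a symmetric positive definite bilinear form,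
   that induces the norm of H. *)
Definition induces_norm (R : realType) (H : completeNormedModType R)
    (dot : {dot H for @idfun R}) : Prop :=
  forall x : H, `|x| = Num.sqrt (dot x x).

Definition hyperplane (R : realType) (H : completeNormedModType R)
    (dot : {dot H for @idfun R}) (u : H) (eta : R) : set H :=
  [set x | dot x u = eta].

Definition halfspace (R : realType) (H : completeNormedModType R)
    (dot : {dot H for @idfun R}) (u : H) (eta : R) : set H :=
  [set x | dot x u <= eta].

Definition nearest_point (R : realType) (H : completeNormedModType R)
    (C : set H) (x p : H) : Prop :=
  C p /\ forall y, C y -> `|x - p| <= `|x - y|.

(* The default value x is only used when x has no unique nearest point in C;
   in a Hilbert space this never happens for C nonempty, closed and convex. *)
Definition metric_proj (R : realType) (H : completeNormedModType R)
    (C : set H) (x : H) : H :=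
  xget x (unique (nearest_point C x)).

(* MathComp's free is restricted to finite-dimensional spaces. *)
Definition lin_dependent (R : realType) (H : lmodType R) (u v : H) : Prop :=
  exists a b : R, ~ (a = 0 /\ b = 0) /\ a *: u + b *: v = 0.

Definition lin_independent (R : realType) (H : lmodType R) (u v : H) : Prop :=
  forall a b : R, a *: u + b *: v = 0 -> a = 0 /\ b = 0.

(* Main.v *)
Require Import Defs.
From HB Require Import structures.
From mathcomp Require Import all_boot all_order all_algebra sesquilinear.
From mathcomp Require Import all_classical all_reals all_analysis.
From mathcomp Require Import ring lra.
Import Order.TTheory GRing.Theory Num.Theory.
Import numFieldNormedType.Exports.
Local Open Scope classical_set_scope.
Local Open Scope ring_scope.

(** A point [p] of a convex set [C] is the projection of [x] as soon as
    [x - p] makes a nonacute angle with every direction from [p] into [C]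
    ([metric_proj_variational]).  This turns the projections onto [H1], [W2]
    and their intersection into explicit formulas, and leaves plane geometry.

    If [u1] and [u2] are dependent, then [H1] is either the whole space or a
    hyperplane contained in [W2], and both products reduce to one projection.

    If they are independent, every [x] is [p + a u1 + b u2], where [p] is its
    projection onto the intersection of [H1] with the boundary of [W2]
    ([plane_pt_exists]), and all the projections involved act on the
    coordinates [(a, b)].  Write [A], [B], [c] for [dot u1 u1], [dot u2 u2],
    [dot u1 u2], so that [gamma ^+ 2 = c ^+ 2 / (A * B)].
    - The projection of [x] onto [H1 `&` W2] is [p] when [b >= 0]; when
      [b <= 0] it is the projection onto [H1], and one step of the method
      reaches it.  If [c = 0], the two projections act on separate coordinates
      and commute.
    - For [b >= 0], the projection onto [H1] does not increase the distance to
      [p], and the next one moves a point of the line [p + R (u2 - (c/A) u1)]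
      to the line [p + R (u1 - (c/B) u2)]; the angle between these lines has
      cosine [gamma], so the distance to [p] is multiplied by [gamma]
      ([proj_comp_contract]).  The second coordinate stays nonnegative, so [p]
      remains the limit and the estimate iterates.
    - For the reversed product, if [x] is in [W2] then the sequence is that of
      the first product.  If [x] is not in [W2] and neither is
      [metric_proj H1 (metric_proj W2 x)], then again [b >= 0]
      ([second_coord_gt0]), and the iterates stay on a ray of [H1] issued from
      [p], shrinking by [gamma] at the first step and by [gamma ^+ 2] at each
      of the following ones ([iter_proj_comp_rev_bound]). *)

(** * The inner product *)

Section InnerProduct.
Variables (R : realType) (H : completeNormedModType R).
Variable dot : {dot H for @idfun R}.

Lemma dotC x y : dot x y = dot y x.
Proof. by rewrite hermC expr0 mul1r. Qed.

Lemma dotDl x y z : dot (x + y) z = dot x z + dot y z.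
Proof. by rewrite linearDl. Qed.

Lemma dotBl x y z : dot (x - y) z = dot x z - dot y z.
Proof. by rewrite linearBl. Qed.

Lemma dotZl a x z : dot (a *: x) z = a * dot x z.
Proof. by rewrite linearZl_LR. Qed.

Lemma dotNl x z : dot (- x) z = - dot x z.
Proof. by rewrite linearNl. Qed.

Lemma dot0l z : dot 0 z = 0.
Proof. by rewrite linear0l. Qed.

Lemma dotDr x y z : dot z (x + y) = dot z x + dot z y.
Proof. by rewrite !(dotC z) dotDl. Qed.

Lemma dotNr x z : dot z (- x) = - dot z x.
Proof. by rewrite !(dotC z) dotNl. Qed.

Lemma dotZr a x z : dot z (a *: x) = a * dot z x.
Proof. by rewrite !(dotC z) dotZl. Qed.

Definition dotE := (dotDl, dotDr, dotNl, dotNr, dotZl, dotZr).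

Lemma dot_gt0 x : x != 0 -> 0 < dot x x.
Proof. exact: neq0_dnorm_gt0. Qed.

Lemma dot_ge0 x : 0 <= dot x x.
Proof.
by have [->|/dot_gt0/ltW//] := eqVneq x 0; rewrite dot0l.
Qed.

Lemma lin_independentC (u v : H) : lin_independent u v -> lin_independent v u.
Proof. by move=> uv a b; rewrite addrC => /uv[]. Qed.

Lemma lin_independent_neq0 (u v : H) : lin_independent u v -> u != 0.
Proof.
move=> uv; apply/eqP => u0; have [] := uv 1 0; last by move/eqP; rewrite oner_eq0.
by rewrite u0 scaler0 scale0r addr0.
Qed.

(** The Gram determinant is, up to the factor [dot u u], the squared norm of
    the component of [v] orthogonal to [u], which does not vanish. *)
Lemma gram_gt0 (u v : H) : lin_independent u v ->
  0 < dot u u * dot v v - dot u v ^+ 2.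
Proof.
move=> uv; have A0 : 0 < dot u u.
  by apply: dot_gt0; exact: lin_independent_neq0 uv.
have w0 : - dot u v *: u + dot u u *: v != 0.
  by apply/eqP => /uv[_ A]; rewrite A ltxx in A0.
have := dot_gt0 _ w0; rewrite !dotE (dotC v u).
have -> : - dot u v * (- dot u v * dot u u) + - dot u v * (dot u u * dot u v) +
          (dot u u * (- dot u v * dot u v) + dot u u * (dot u u * dot v v)) =
          dot u u * (dot u u * dot v v - dot u v ^+ 2) by ring.
by rewrite pmulr_rgt0.
Qed.

Hypothesis dot_norm : induces_norm dot.

Lemma sqr_normE x : `|x| ^+ 2 = dot x x.
Proof. by rewrite dot_norm sqr_sqrtr // dot_ge0. Qed.

Lemma ler_norm_dot g x y : 0 <= g -> dot x x <= g ^+ 2 * dot y y ->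
  `|x| <= g * `|y|.
Proof.
move=> g0 h; rewrite -(@ler_pXn2r _ 2) ?nnegrE ?mulr_ge0 ?normr_ge0 //.
by rewrite exprMn !sqr_normE.
Qed.

(** * Projections onto hyperplanes and half-spaces *)

(** If [x - p] makes a nonacute angle with every direction pointing from [p]
    into [C], then [|x - y|^2 >= |x - p|^2 + |p - y|^2] for [y] in [C], so [p]
    is nearest, and any other nearest point is at distance 0 from it. *)
Lemma metric_proj_variational (C : set H) x p : C p ->
  (forall y, C y -> dot (x - p) (y - p) <= 0) -> metric_proj C x = p.
Proof.
move=> Cp hp.
have pyth y : C y -> `|x - p| ^+ 2 + `|p - y| ^+ 2 <= `|x - y| ^+ 2.
  move=> /hp; rewrite !sqr_normE !dotE (dotC p x) (dotC y x) (dotC y p).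
  lra.
have pn : nearest_point C x p.
  split=> // y /pyth h; rewrite -(@ler_pXn2r _ 2) ?nnegrE //.
  by apply: le_trans h; rewrite lerDl sqr_ge0.
have uniq_p q : nearest_point C x q -> p = q.
  move=> [Cq /(_ p Cp) hq]; have := pyth q Cq.
  rewrite -(@ler_pXn2r _ 2) ?nnegrE // in hq => h.
  have : `|p - q| ^+ 2 <= 0 by lra.
  rewrite exprn_even_le0 //= normr_eq0 subr_eq0 => /eqP; exact.
apply: xget_unique; first by [].
by move=> q [qn _]; rewrite (uniq_p q qn).
Qed.

Lemma metric_proj_id (C : set H) x : C x -> metric_proj C x = x.
Proof.
by move=> Cx; apply: metric_proj_variational => // y _; rewrite subrr dot0l.
Qed.

Lemma metric_proj_hyperplane u eta x : u != 0 ->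
  metric_proj (hyperplane dot u eta) x =
  x - ((dot x u - eta) / dot u u) *: u.
Proof.
move=> /dot_gt0 A0; have An : dot u u != 0 by rewrite gt_eqF.
set t := _ / _; have px : dot (x - t *: u) u = eta.
  by rewrite !dotE /t; field.
apply: metric_proj_variational => // y yH.
by rewrite subKr dotZl dotC dotBl px yH subrr mulr0.
Qed.

Lemma metric_proj_halfspace u eta x : u != 0 -> eta <= dot x u ->
  metric_proj (halfspace dot u eta) x =
  x - ((dot x u - eta) / dot u u) *: u.
Proof.
move=> /dot_gt0 A0 xu; have An : dot u u != 0 by rewrite gt_eqF.
set t := _ / _; have px : dot (x - t *: u) u = eta.
  by rewrite !dotE /t; field.
apply: metric_proj_variational => [|y yW]; first by rewrite /halfspace /= px.
rewrite subKr dotZl dotC dotBl px mulr_ge0_le0 ?subr_le0 //.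
by rewrite divr_ge0 ?subr_ge0 // ltW.
Qed.

Lemma metric_proj_hyperplane_shift u eta x t : u != 0 ->
  metric_proj (hyperplane dot u eta) (x + t *: u) =
  metric_proj (hyperplane dot u eta) x.
Proof.
move=> u0; rewrite !metric_proj_hyperplane // -addrA -scalerBl; congr (_ + _).
have An : dot u u != 0 by rewrite gt_eqF // dot_gt0.
by rewrite -[RHS]scaleNr; congr (_ *: _); rewrite !dotE; field.
Qed.

(** * Linearly dependent normals *)

Section Dependent.
Variables (u1 u2 : H) (eta1 eta2 : R).
Let H1 := hyperplane dot u1 eta1.
Let W2 := halfspace dot u2 eta2.

(** When [u1] vanishes, [H1] is the whole space.  Otherwise [u2] is a
    multiple of [u1], so [dot _ u2] is constant on [H1], and [H1] is contained
    in [W2] as soon as it meets it. *)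
Lemma metric_proj_comm_dependent : lin_dependent u1 u2 -> H1 `&` W2 !=set0 ->
  metric_proj W2 \o metric_proj H1 = metric_proj (H1 `&` W2) /\
  metric_proj (H1 `&` W2) = metric_proj H1 \o metric_proj W2.
Proof.
move=> [a [b [ab0 abE]]] [z [zH zW]].
have [u10|u1n] := eqVneq u1 0.
  have HT x : H1 x by rewrite /H1 /hyperplane /= -zH u10 !(dotC _ 0) !dot0l.
  have -> : H1 `&` W2 = W2 by apply/seteqP; split=> x // [].
  have idH : metric_proj H1 = id by apply/funext => x; apply: metric_proj_id.
  by rewrite idH; split; apply/funext.
(* Otherwise [a u1 = 0] with [u1 != 0], and both coefficients vanish. *)
have b0 : b != 0.
  apply/eqP => b0; apply: ab0; split=> //; move: abE.
  by rewrite b0 scale0r addr0 => /eqP; rewrite scaler_eq0 (negPf u1n) orbF => /eqP.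
pose k := - (b^-1 * a).
have u2E : u2 = k *: u1.
  apply/eqP; rewrite /k scaleNr -scalerA -addr_eq0 -(inj_eq (scalerI b0)).
  by rewrite scalerDr [b *: (b^-1 *: _)]scalerA mulfV // scale1r addrC abE scaler0.
have HW x : H1 x -> W2 x.
  move: zH zW; rewrite /H1 /W2 /hyperplane /halfspace /= u2E => zH zW xH.
  by rewrite dotZr xH -zH -dotZr.
have PH x : H1 (metric_proj H1 x).
  rewrite metric_proj_hyperplane // /H1 /hyperplane /= !dotE.
  have An : dot u1 u1 != 0 by rewrite gt_eqF // dot_gt0.
  by field.
have -> : H1 `&` W2 = H1 by apply/seteqP; split=> [x []|x] //; split=> //; apply: HW.
split; apply/funext => x /=; first by rewrite metric_proj_id //; apply: HW.
have [xW|xW] := leP (dot x u2) eta2; first by rewrite (metric_proj_id W2).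
have u2n : u2 != 0.
  apply/eqP => u20; move: zW xW.
  by rewrite /W2 /halfspace /= u20 !(dotC _ 0) !dot0l leNgt => /negP.
rewrite (metric_proj_halfspace _ _ _ u2n (ltW xW)) [X in _ *: X]u2E -scaleNr scalerA.
by rewrite metric_proj_hyperplane_shift.
Qed.

End Dependent.

(** * Linearly independent normals: coordinates in the normal plane *)

Section Independent.
Variables (u1 u2 : H) (eta1 eta2 : R).
Hypothesis u12 : lin_independent u1 u2.
Let H1 := hyperplane dot u1 eta1.
Let W2 := halfspace dot u2 eta2.
Let A := dot u1 u1.
Let B := dot u2 u2.
Let c := dot u1 u2.
Let T := metric_proj W2 \o metric_proj H1.
Let S := metric_proj H1 \o metric_proj W2.

Let u1n : u1 != 0. Proof. exact: lin_independent_neq0 u12. Qed.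
Let u2n : u2 != 0.
Proof. exact: (lin_independent_neq0 _ _ (lin_independentC _ _ u12)). Qed.
Let A0 : 0 < A. Proof. exact: dot_gt0. Qed.
Let B0 : 0 < B. Proof. exact: dot_gt0. Qed.
Let An : A != 0. Proof. by rewrite gt_eqF. Qed.
Let Bn : B != 0. Proof. by rewrite gt_eqF. Qed.
Let G0 : 0 < A * B - c ^+ 2. Proof. exact: gram_gt0. Qed.

Definition plane_pt (p : H) (a b : R) : H := p + (a *: u1 + b *: u2).

Lemma plane_pt00 p : plane_pt p 0 0 = p.
Proof. by rewrite /plane_pt !scale0r !addr0. Qed.

(** The coordinates of [x] solve a linear system whose determinant is the Gram
    determinant of [u1] and [u2]. *)
Lemma plane_pt_exists x : exists p a b,
  [/\ dot p u1 = eta1, dot p u2 = eta2 & x = plane_pt p a b].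
Proof.
have Gn : A * B - c ^+ 2 != 0 by rewrite gt_eqF.
pose r := dot x u1 - eta1; pose s := dot x u2 - eta2.
pose a := (r * B - s * c) / (A * B - c ^+ 2).
pose b := (s * A - r * c) / (A * B - c ^+ 2).
exists (x - (a *: u1 + b *: u2)), a, b; split; last by rewrite /plane_pt subrK.
  rewrite !dotE (dotC u2 u1) -/A -/c; apply: (@addIr _ (- eta1)).
  by rewrite subrr addrAC -/r /a /b; field.
rewrite !dotE -/B -/c; apply: (@addIr _ (- eta2)).
by rewrite subrr addrAC -/s /a /b; field.
Qed.

Section Coordinates.
Variable p : H.
Hypotheses (p1 : dot p u1 = eta1) (p2 : dot p u2 = eta2).
Local Notation pt := (plane_pt p).

Lemma dot_plane_pt1 a b : dot (pt a b) u1 = eta1 + (a * A + b * c).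
Proof. by rewrite /plane_pt !dotE p1 (dotC u2). Qed.

Lemma dot_plane_pt2 a b : dot (pt a b) u2 = eta2 + (a * c + b * B).
Proof. by rewrite /plane_pt !dotE p2. Qed.

Lemma halfspace_plane_pt a b : W2 (pt a b) <-> a * c + b * B <= 0.
Proof. by rewrite /W2 /halfspace /= dot_plane_pt2 gerDl. Qed.

Lemma metric_proj_H1_plane_pt a b :
  metric_proj H1 (pt a b) = pt (- (b * c / A)) b.
Proof.
rewrite metric_proj_hyperplane // dot_plane_pt1 -/A /plane_pt -addrA; congr (_ + _).
by rewrite addrAC -scalerBl; congr (_ *: _ + _); field.
Qed.

Lemma metric_proj_W2_plane_pt_in a b : a * c + b * B <= 0 ->
  metric_proj W2 (pt a b) = pt a b.
Proof. by move=> /halfspace_plane_pt; apply: metric_proj_id. Qed.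

Lemma metric_proj_W2_plane_pt_out a b : 0 <= a * c + b * B ->
  metric_proj W2 (pt a b) = pt a (- (a * c / B)).
Proof.
move=> ab0; rewrite metric_proj_halfspace ?dot_plane_pt2 ?lerDl //.
rewrite -/B /plane_pt -!addrA; congr (_ + (_ + _)).
by rewrite -scalerBl; congr (_ *: _); field.
Qed.

(** Since [p] lies on both boundaries, [x - p = a u1 + b u2] with [b >= 0] is
    the normal-cone condition at [p]: the multiplier [a] of the equality
    constraint is free, that of the inequality constraint is nonnegative. *)
Lemma metric_proj_H1W2_plane_pt_ge0 a b : 0 <= b ->
  metric_proj (H1 `&` W2) (pt a b) = p.
Proof.
move=> b0; apply: metric_proj_variational.
  by split; rewrite /H1 /W2 /hyperplane /halfspace /= ?p1 ?p2.
move=> y [yH yW]; rewrite /plane_pt addrAC subrr add0r dotDl !dotZl.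
rewrite !(dotC _ (y - p)) !dotBl p1 p2 yH subrr mulr0 add0r.
by rewrite mulr_ge0_le0 // subr_le0.
Qed.

Lemma H1_plane_pt_level b :
  - (b * c / A) * c + b * B = b * ((A * B - c ^+ 2) / A).
Proof. by field. Qed.

Let GA0 : 0 < (A * B - c ^+ 2) / A. Proof. exact: divr_gt0. Qed.

(** The right-hand side is the projection onto [H1]; it lies in [W2] because,
    along [H1], [dot _ u2] increases with the second coordinate. *)
Lemma metric_proj_H1W2_plane_pt_le0 a b : b <= 0 ->
  metric_proj (H1 `&` W2) (pt a b) = pt (- (b * c / A)) b.
Proof.
move=> b0; apply: metric_proj_variational.
  split; last by apply/halfspace_plane_pt; rewrite H1_plane_pt_level mulr_le0_ge0 // ltW.
  by rewrite /H1 /hyperplane /= dot_plane_pt1; field.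
move=> y [yH _].
have -> : pt a b - pt (- (b * c / A)) b = (a + b * c / A) *: u1.
  by rewrite /plane_pt opprD addrACA subrr add0r opprD addrACA subrr addr0
             -scalerBl opprK.
rewrite dotZl dotC dotBl dot_plane_pt1 yH.
have -> : eta1 - (eta1 + (- (b * c / A) * A + b * c)) = 0 by field.
by rewrite mulr0.
Qed.

Lemma dot_plane_ptB a b :
  dot (pt a b - p) (pt a b - p) = a ^+ 2 * A + a * b * c *+ 2 + b ^+ 2 * B.
Proof.
rewrite /plane_pt addrAC subrr add0r !dotE (dotC u2 u1) -/A -/B -/c.
by ring.
Qed.

Lemma proj_comp_plane_pt_ge0 a b : 0 <= b ->
  T (pt a b) = pt (- (b * c / A)) (b * (c ^+ 2 / (A * B))).
Proof.
move=> b0; rewrite /T /= metric_proj_H1_plane_pt metric_proj_W2_plane_pt_out.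
  by congr (pt _ _); field; apply/andP.
by rewrite H1_plane_pt_level mulr_ge0 // ltW.
Qed.

Lemma proj_comp_plane_pt_le0 a b : b <= 0 ->
  T (pt a b) = pt (- (b * c / A)) b.
Proof.
move=> b0; rewrite /T /= metric_proj_H1_plane_pt metric_proj_W2_plane_pt_in //.
by rewrite H1_plane_pt_level mulr_le0_ge0 // ltW.
Qed.

Lemma dot_H1_plane_ptB b :
  dot (pt (- (b * c / A)) b - p) (pt (- (b * c / A)) b - p) =
  b ^+ 2 * ((A * B - c ^+ 2) / A).
Proof. by rewrite dot_plane_ptB; field. Qed.

(** * Contraction estimates *)

Variable g : R.
Hypotheses (g0 : 0 <= g) (gE : g ^+ 2 = c ^+ 2 / (A * B)).

Let g2_le1 : g ^+ 2 <= 1.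
Proof.
by rewrite gE ler_pdivrMr ?mulr_gt0 // mul1r -subr_ge0 ltW.
Qed.

(** By Pythagoras, dropping the [u1]-component of [x - p] leaves the squared
    length [b ^+ 2 * (A * B - c ^+ 2) / A]; projecting the resulting vector,
    orthogonal to [u1], onto the orthogonal of [u2] multiplies it by exactly
    [g ^+ 2]. *)
Lemma proj_comp_contract a b : 0 <= b ->
  `|T (pt a b) - p| <= g * `|pt a b - p|.
Proof.
move=> b0; rewrite proj_comp_plane_pt_ge0 //; apply: ler_norm_dot => //.
rewrite !dot_plane_ptB.
have -> : (- (b * c / A)) ^+ 2 * A +
    - (b * c / A) * (b * (c ^+ 2 / (A * B))) * c *+ 2 +
    (b * (c ^+ 2 / (A * B))) ^+ 2 * B =
    g ^+ 2 * (b ^+ 2 * ((A * B - c ^+ 2) / A)).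
  by rewrite gE; field; apply/andP.
apply: ler_wpM2l; first exact: sqr_ge0.
rewrite -subr_ge0.
have -> : a ^+ 2 * A + a * b * c *+ 2 + b ^+ 2 * B -
    b ^+ 2 * ((A * B - c ^+ 2) / A) = (a * A + b * c) ^+ 2 / A by field.
by rewrite divr_ge0 ?sqr_ge0 // ltW.
Qed.

Lemma iter_proj_comp_bound a b k : 0 <= b ->
  `|iter k T (pt a b) - p| <= g ^+ k * `|pt a b - p|.
Proof.
elim: k a b => [|k IHk] a b b0; first by rewrite expr0 mul1r.
have b'0 : 0 <= b * (c ^+ 2 / (A * B)).
  by rewrite mulr_ge0 // divr_ge0 ?sqr_ge0 // mulr_ge0 // ltW.
rewrite iterSr exprSr -mulrA.
apply: le_trans (ler_wpM2l (exprn_ge0 k g0) (proj_comp_contract a _ b0)).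
by rewrite proj_comp_plane_pt_ge0 //; apply: IHk.
Qed.

(** The first step already lands on the projection onto [H1 `&` W2], which [T]
    fixes. *)
Lemma iter_proj_comp_fix a b k : b <= 0 ->
  iter k.+1 T (pt a b) = pt (- (b * c / A)) b.
Proof.
move=> b0; rewrite iterSr proj_comp_plane_pt_le0 //.
by elim: k => //= k ->; apply: proj_comp_plane_pt_le0.
Qed.

(** The second coordinate of the projection onto [W2] is [- (a * c / B)],
    which the projection onto [H1] keeps; it is positive because the latter
    point is outside [W2].  As the initial point is also outside [W2], its own
    second coordinate [b] is even larger. *)
Lemma second_coord_gt0 a b : ~ W2 (pt a b) ->
  ~ W2 (metric_proj H1 (metric_proj W2 (pt a b))) ->
  0 < - (a * c / B) /\ 0 <= b /\
  S (pt a b) = pt (- (- (a * c / B) * c / A)) (- (a * c / B)).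
Proof.
move=> /halfspace_plane_pt/negP; rewrite -ltNge => ab0.
rewrite /S /= (metric_proj_W2_plane_pt_out _ _ (ltW ab0)) metric_proj_H1_plane_pt.
move=> /halfspace_plane_pt/negP; rewrite -ltNge H1_plane_pt_level.
rewrite pmulr_lgt0 // => b10; split=> //; split=> //.
have acE : a * c = a * c / B * B by field.
rewrite -(pmulr_lge0 _ B0); apply: ltW; apply: lt_trans ab0 _.
by rewrite gtrDr acE pmulr_llt0 // -oppr_gt0.
Qed.

Lemma proj_comp_rev_H1 b : 0 <= b ->
  S (pt (- (b * c / A)) b) =
  pt (- (b * (c ^+ 2 / (A * B)) * c / A)) (b * (c ^+ 2 / (A * B))).
Proof.
move=> b0; rewrite /S /= metric_proj_W2_plane_pt_out; last first.
  by rewrite H1_plane_pt_level mulr_ge0 // ltW.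
rewrite metric_proj_H1_plane_pt.
by congr (pt _ _); field; apply/andP.
Qed.

(** Points of [H1] with nonnegative second coordinate form a ray from [p] that
    [S] shrinks by [g ^+ 2 <= g]; the first step, which starts off [H1],
    contributes a single factor [g]. *)
Lemma iter_proj_comp_rev_bound a b k : ~ W2 (pt a b) ->
  ~ W2 (metric_proj H1 (metric_proj W2 (pt a b))) ->
  `|iter k S (pt a b) - p| <= g ^+ k * `|pt a b - p|.
Proof.
move=> xW yW; case: k => [|k]; first by rewrite expr0 mul1r.
have [b10 [b0 SE]] := second_coord_gt0 a b xW yW.
have ray d : 0 <= d -> `|iter k S (pt (- (d * c / A)) d) - p| <=
                 g ^+ k * `|pt (- (d * c / A)) d - p|.
  elim: k d => [|k IHk] d d0; first by rewrite expr0 mul1r.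
  have d'0 : 0 <= d * (c ^+ 2 / (A * B)).
    by rewrite mulr_ge0 // divr_ge0 ?sqr_ge0 // mulr_ge0 // ltW.
  rewrite iterSr proj_comp_rev_H1 //; apply: le_trans (IHk _ d'0) _.
  rewrite (exprSr g k) -[leRHS]mulrA; apply: ler_wpM2l; first exact: exprn_ge0.
  apply: ler_norm_dot => //; rewrite !dot_H1_plane_ptB -gE [leRHS]mulrA.
  apply: ler_wpM2r; first exact: ltW.
  rewrite exprMn mulrC; apply: ler_wpM2r; first exact: sqr_ge0.
  by rewrite expr2 ler_piMl // sqr_ge0.
rewrite iterSr SE; apply: le_trans (ray _ (ltW b10)) _.
rewrite (exprSr g k) -[leRHS]mulrA; apply: ler_wpM2l; first exact: exprn_ge0.
apply: ler_norm_dot => //; rewrite dot_H1_plane_ptB dot_plane_ptB.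
have -> : (- (a * c / B)) ^+ 2 * ((A * B - c ^+ 2) / A) =
    g ^+ 2 * (a ^+ 2 * ((A * B - c ^+ 2) / B)).
  by rewrite gE; field; apply/andP.
apply: ler_wpM2l; first exact: sqr_ge0.
rewrite -subr_ge0.
have -> : a ^+ 2 * A + a * b * c *+ 2 + b ^+ 2 * B -
    a ^+ 2 * ((A * B - c ^+ 2) / B) = (a * c + b * B) ^+ 2 / B by field.
by rewrite divr_ge0 ?sqr_ge0 // ltW.
Qed.

End Coordinates.

(** * Rates of convergence *)

(** In the orthogonal case the coordinates decouple: projecting onto [H1]
    replaces [a] by 0, projecting onto [W2] replaces [b] by [min b 0]. *)
Lemma metric_proj_comm_orthogonal : dot u1 u2 = 0 ->
  T = metric_proj (H1 `&` W2) /\ metric_proj (H1 `&` W2) = S.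
Proof.
rewrite -/c => c0.
suff E x : T x = metric_proj (H1 `&` W2) x /\ S x = metric_proj (H1 `&` W2) x.
  by split; apply/funext => x; have [] := E x.
have [p [a [b [p1 p2 ->]]]] := plane_pt_exists x.
have H1E d e : metric_proj H1 (plane_pt p d e) = plane_pt p 0 e.
  by rewrite metric_proj_H1_plane_pt // c0 mulr0 mul0r oppr0.
rewrite /T /S /= H1E; have [b0|b0] := leP 0 b.
  have bB d : 0 <= d * c + b * B by rewrite c0 mulr0 add0r mulr_ge0 // ltW.
  rewrite metric_proj_H1W2_plane_pt_ge0 // !metric_proj_W2_plane_pt_out //.
  by rewrite H1E c0 !mulr0 mul0r oppr0 plane_pt00.
have bB d : d * c + b * B <= 0.
  by rewrite c0 mulr0 add0r mulr_le0_ge0 // ltW.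
rewrite metric_proj_H1W2_plane_pt_le0 // ?ltW // !metric_proj_W2_plane_pt_in //.
by rewrite H1E c0 mulr0 mul0r oppr0.
Qed.

Let g := `|dot u1 u2| / (`|u1| * `|u2|).

Let g0 : 0 <= g.
Proof. by rewrite divr_ge0 ?mulr_ge0. Qed.

Let gE : g ^+ 2 = c ^+ 2 / (A * B).
Proof. by rewrite expr_div_n exprMn !sqr_normE real_normK ?num_real. Qed.

Lemma cos_angle_lt1 : 0 <= g < 1.
Proof.
rewrite g0 /= -(@ltr_pXn2r _ 2) ?nnegrE ?ler01 // expr1n gE.
by rewrite ltr_pdivrMr ?mulr_gt0 // mul1r -subr_gt0.
Qed.

Lemma iter_proj_comp_rate x k :
  `|iter k T x - metric_proj (H1 `&` W2) x| <=
  g ^+ k * `|x - metric_proj (H1 `&` W2) x|.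
Proof.
have [p [a [b [p1 p2 ->]]]] := plane_pt_exists x.
have [b0|b0] := leP 0 b.
  by rewrite metric_proj_H1W2_plane_pt_ge0 //; apply: iter_proj_comp_bound.
case: k => [|k]; first by rewrite expr0 mul1r.
have {}b0 := ltW b0; rewrite iter_proj_comp_fix ?metric_proj_H1W2_plane_pt_le0 //.
by rewrite subrr normr0 mulr_ge0 ?exprn_ge0.
Qed.

Lemma iter_proj_comp_rev_rate_in x k : W2 x ->
  `|metric_proj W2 (iter k S x) - metric_proj (H1 `&` W2) x| <=
  g ^+ k * `|x - metric_proj (H1 `&` W2) x|.
Proof.
move=> xW; have -> : metric_proj W2 (iter k S x) = iter k T x.
  by elim: k => [|k /= <- //]; apply: metric_proj_id.
exact: iter_proj_comp_rate.
Qed.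

Lemma iter_proj_comp_rev_rate_out x k : ~ W2 x ->
  ~ (H1 `&` W2) (metric_proj H1 (metric_proj W2 x)) ->
  `|iter k S x - metric_proj (H1 `&` W2) x| <=
  g ^+ k * `|x - metric_proj (H1 `&` W2) x|.
Proof.
move=> xW yHW.
have yW : ~ W2 (metric_proj H1 (metric_proj W2 x)).
  move=> yW; apply: yHW; split=> //.
  rewrite metric_proj_hyperplane // /H1 /hyperplane /= !dotE -/A.
  by field.
have [p [a [b [p1 p2 xE]]]] := plane_pt_exists x; rewrite xE in xW yW *.
have [_ [b0 _]] := second_coord_gt0 p p1 p2 a b xW yW.
by rewrite metric_proj_H1W2_plane_pt_ge0 //; apply: iter_proj_comp_rev_bound.
Qed.

End Independent.
End InnerProduct.

(** * The dichotomy *)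

Lemma lin_dependent_or_independent (R : realType) (H : lmodType R) (u v : H) :
  lin_dependent u v \/ lin_independent u v.
Proof.
have [|nd] := pselect (lin_dependent u v); [by left|right=> a b abE].
by apply: contrapT => nab; apply: nd; exists a, b.
Qed.

Theorem theorem6p5 (R : realType) (H : completeNormedModType R)
    (dot : {dot H for @idfun R}) (dot_norm : induces_norm dot)
    (u1 u2 : H) (eta1 eta2 : R) :
  let H1 := hyperplane dot u1 eta1 in
  let W2 := halfspace dot u2 eta2 in
  (lin_dependent u1 u2 \/ lin_independent u1 u2) /\
  ~ (lin_dependent u1 u2 /\ lin_independent u1 u2) /\
  (lin_dependent u1 u2 -> H1 `&` W2 !=set0 ->
     metric_proj W2 \o metric_proj H1 = metric_proj (H1 `&` W2) /\
     metric_proj (H1 `&` W2) = metric_proj H1 \o metric_proj W2) /\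
  (lin_independent u1 u2 ->
     (dot u1 u2 = 0 ->
        metric_proj W2 \o metric_proj H1 = metric_proj (H1 `&` W2) /\
        metric_proj (H1 `&` W2) = metric_proj H1 \o metric_proj W2) /\
     (dot u1 u2 <> 0 ->
        let gamma := `|dot u1 u2| / (`|u1| * `|u2|) in
        (0 <= gamma < 1) /\
        (forall (x : H) (k : nat),
           `|iter k (metric_proj W2 \o metric_proj H1) x - metric_proj (H1 `&` W2) x|
             <= gamma ^+ k * `|x - metric_proj (H1 `&` W2) x|) /\
        (forall (x : H) (k : nat),
           ~ (H1 `&` W2) (metric_proj H1 (metric_proj W2 x)) ->
           (W2 x ->
              `|metric_proj W2 (iter k (metric_proj H1 \o metric_proj W2) x)
                  - metric_proj (H1 `&` W2) x|
                <= gamma ^+ k * `|x - metric_proj (H1 `&` W2) x|) /\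
           ((~` W2) x ->
              `|iter k (metric_proj H1 \o metric_proj W2) x - metric_proj (H1 `&` W2) x|
                <= gamma ^+ k * `|x - metric_proj (H1 `&` W2) x|)))).
Proof.
move=> H1 W2; split; first exact: lin_dependent_or_independent.
split; first by move=> [[a [b [ab0 abE]]] /(_ a b abE)].
split; first exact: metric_proj_comm_dependent.
move=> u12; split; first exact: metric_proj_comm_orthogonal.
move=> _ g; split; first exact: cos_angle_lt1.
split; first exact: iter_proj_comp_rate.
move=> x k yHW; split=> [xW|xW]; first exact: iter_proj_comp_rev_rate_in.
exact: iter_proj_comp_rev_rate_out.
Qed.
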